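(* For $n\ge 1$, $a_n(12;1\to 3)=S_{n-1}$, the $(n-1)$-st large Schröder number.
   Context: Standard cycle form of $\sigma\in S_n$: product of disjoint cycles (fixed points included), each cycle starting with its largest element, cycles listed in increasing order of largest elements. The fundamental bijection $\theta:S_n\to S_n$ erases the parentheses of the standard cycle form to give a one-line permutation. For $\pi\in S_n$, $\hat\pi=\theta^{-1}(\pi)$. An arrow pattern $(\nu;H)$ of size $k$: a string $\nu=a_1\dots a_m$ of positive integers and a set $H$ of arrows $b\to c$, with all integers appearing forming $[k]$. $\pi\in S_n$ contains $(\nu;H)$ if there is $X=\{x_1<\dots<x_k\}\subseteq[n]$ with positions $t_1<\dots<t_m$ such that $\pi_{t_1}\cdots\pi_{t_m}=x_{a_1}\cdots x_{a_m}$ and $\hat\pi(x_b)=x_c$ for every arrow $b\to c\in H$; otherwise it avoids it. $a_n(\nu;H)$ = number of $\pi\in S_n$ avoiding $(\nu;H)$. The large Schröder numbers $S_m$ ($S_0=1,S_1=2,S_2=6,S_3=22,\dots$, OEIS A006318) count lattice paths from $(0,0)$ to $(m,m)$ with steps $(1,0),(0,1),(1,1)$ never going above the diagonal. *)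

(* Defs.v *)
From HB Require Import structures.
From mathcomp Require Import all_boot fingroup perm.
Set Implicit Arguments.
Unset Strict Implicit.
Unset Printing Implicit Defensive.

(* [n] is represented by 'I_n, i.e. every integer is shifted down by one, both
   as a position and as a value; pi : 'S_n is the one-line word
   pi 0, pi 1, ..., pi (n-1). *)

Section FundamentalBijection.

Variable n : nat.
Implicit Types (s t : 'S_n) (i m x : 'I_n).

Definition cycle_max s m := all (fun i : 'I_n => i <= m) (orbit s m).

(* enum 'I_n is increasing, and orbit s m = [:: m; s m; s (s m); ...]. *)
Definition std_cycle_form s : seq (seq 'I_n) :=
  [seq orbit s m | m <- enum 'I_n & cycle_max s m].

Definition theta_word s : seq 'I_n := flatten (std_cycle_form s).

Lemma orbit_cycle_max s i :
  exists m, [/\ cycle_max s m, orbit s m \in std_cycle_form s & i \in orbit s m].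
Proof.
have si : i \in orbit s i by rewrite -fconnect_orbit connect0.
case: (@arg_maxnP _ i (fun j => j \in orbit s i) (fun j : 'I_n => j : nat) si) => m mi mmax.
have sim : fconnect s i m by rewrite fconnect_orbit.
have cm : cycle_max s m.
  apply/allP=> j; rewrite -fconnect_orbit => mj; apply: mmax.
  suff: j \in orbit s i by [].
  by rewrite -fconnect_orbit; apply: connect_trans sim mj.
exists m; split=> //.
  by apply: map_f; rewrite mem_filter cm mem_enum.
by rewrite -fconnect_orbit (fconnect_sym perm_inj).
Qed.

Lemma mem_theta_word s i : i \in theta_word s.
Proof. by have [m [_ ? ?]] := orbit_cycle_max s i; apply/flattenP; exists (orbit s m). Qed.

Lemma theta_word_uniq s : uniq (theta_word s).
Proof.
rewrite /theta_word /std_cycle_form.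
have: uniq [seq m <- enum 'I_n | cycle_max s m] by rewrite filter_uniq ?enum_uniq.
have: all (cycle_max s) [seq m <- enum 'I_n | cycle_max s m] by apply: filter_all.
elim: [seq m <- _ | _] => //= m l IHl /andP[cm cl] /andP[ml ul].
rewrite cat_uniq orbit_uniq IHl // andbT; apply/hasPn=> j /flatten_mapP[m' m'l jm'].
apply/negP=> jm; move: ml; suff -> : m = m' by rewrite m'l.
have mm' : fconnect s m m'.
  move: jm jm' => /=; rewrite -!fconnect_orbit => mj m'j.
  by apply: connect_trans mj _; rewrite (fconnect_sym perm_inj).
have m'm : fconnect s m' m by rewrite (fconnect_sym perm_inj).
apply/val_inj/eqP; rewrite eqn_leq.
move: mm' m'm; rewrite !fconnect_orbit => mm' m'm.
by rewrite (allP (allP cl _ m'l) _ m'm) (allP cm _ mm').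
Qed.

Lemma theta_word_size s : size (theta_word s) = n.
Proof.
rewrite -[RHS]card_ord -(card_uniqP (theta_word_uniq s)).
by apply: eq_card => i; rewrite mem_theta_word.
Qed.

Lemma nth_theta_word_inj s : injective (fun i => nth i (theta_word s) i).
Proof.
move=> i j; have szi := theta_word_size s.
rewrite (set_nth_default i j) ?szi // => /eqP.
by rewrite nth_uniq ?szi ?theta_word_uniq // => /eqP/val_inj.
Qed.

Definition theta s : 'S_n := perm (@nth_theta_word_inj s).

Lemma theta_wordE s : [seq theta s i | i <- enum 'I_n] = theta_word s.
Proof.
case En: (enum 'I_n) => [|i0 l].
  have := theta_word_size s; rewrite -[RHS]size_enum_ord En /=.
  by case: (theta_word s).
rewrite -En; apply: (@eq_from_nth _ i0) => [|k].
  by rewrite size_map size_enum_ord theta_word_size.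
rewrite size_map size_enum_ord => lt_kn.
rewrite (nth_map i0) ?size_enum_ord // permE nth_enum_ord //.
by apply: set_nth_default; rewrite theta_word_size.
Qed.

Definition std_cycle (c : seq 'I_n) :=
  if c is m :: c' then all (fun i : 'I_n => i < m) c' else false.

Definition cycle_lt (c d : seq 'I_n) :=
  match c, d with m :: _, m' :: _ => m < m' | _, _ => false end.

Lemma std_cycle_formP s :
  all std_cycle (std_cycle_form s) && sorted cycle_lt (std_cycle_form s).
Proof.
have orbE m : orbit s m = m :: behead (orbit s m).
  by rewrite /orbit -orderSpred.
apply/andP; split.
  apply/allP=> c /mapP[m]; rewrite mem_filter => /andP[cm _] ->.
  have := orbit_uniq s m; rewrite orbE /= => /andP[mN _].
  apply/allP=> j jm; rewrite ltn_neqAle; apply/andP; split.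
    by apply: contraNneq mN => /ord_inj jE; rewrite -{1}jE.
  by apply: (allP cm); rewrite orbE inE jm orbT.
rewrite sorted_map /=; apply: (@sub_sorted _ (fun i j : 'I_n => i < j)).
  by move=> i j /=; rewrite orbE (orbE j).
apply: sorted_filter; first by move=> y x z; apply: ltn_trans.
rewrite -(@sorted_map _ _ (val : 'I_n -> nat) ltn) val_enum_ord.
exact: iota_ltn_sorted.
Qed.

Lemma flatten_std_inj (C D : seq (seq 'I_n)) :
    all std_cycle C && sorted cycle_lt C ->
    all std_cycle D && sorted cycle_lt D ->
  flatten C = flatten D -> C = D.
Proof.
have split_c (m : 'I_n) c (E : seq (seq 'I_n)) : std_cycle (m :: c) ->
    all std_cycle E -> path cycle_lt (m :: c) E ->
    c = take (find (fun i : 'I_n => m < i) (c ++ flatten E)) (c ++ flatten E).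
  move=> /= cm; have nc : has (fun i : 'I_n => m < i) c = false.
    by apply/hasPn=> j /(allP cm); rewrite -leqNgt; apply: ltnW.
  rewrite find_cat nc; case: E => [|[|m' e] E] //=.
    by rewrite addn0 cats0 take_size.
  by move=> _ /andP[-> _]; rewrite addn0 take_size_cat.
elim: C D => [|[|m c] C IH] [|[|m' d] D] //=.
move=> /andP[/andP[sc sC] pC] /andP[/andP[sd sD] pD] [Em E]; subst m'.
have Ec : c = d by rewrite (split_c m c C) // E -(split_c m d D).
subst d; congr cons; apply: IH; last first.
- by move/(congr1 (drop (size c))): E; rewrite !drop_size_cat.
- by rewrite sD (path_sorted pD).
- by rewrite sC (path_sorted pC).
Qed.

Lemma theta_inj : injective theta.
Proof.
move=> s t Est.
have Ew : theta_word s = theta_word t by rewrite -!theta_wordE Est.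
have Ef := flatten_std_inj (std_cycle_formP s) (std_cycle_formP t) Ew.
have nextE u i c : c \in std_cycle_form u -> i \in c -> u i = next c i.
  case/mapP=> m _ -> im.
  by apply/eqP; apply: (next_cycle (cycle_orbit perm_inj m)).
apply/permP=> i; have [m [_ cs im]] := orbit_cycle_max s i.
by rewrite (nextE s i _ cs im); apply/esym/nextE; rewrite -?Ef.
Qed.

Definition hat : 'S_n -> 'S_n := invF theta_inj.

End FundamentalBijection.

(* The letter a of a pattern of size k is the ordinal of value a - 1 in 'I_k. *)
Record arrow_pattern (m k : nat) := ArrowPattern {
  letters : m.-tuple 'I_k;
  arrows : {set 'I_k * 'I_k};
  letters_arrows_cover :
    [forall a : 'I_k, (a \in letters) ||
       [exists c : 'I_k, ((a, c) \in arrows) || ((c, a) \in arrows)]]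
}.

Definition increasing (k n : nat) (x : {ffun 'I_k -> 'I_n}) : bool :=
  [forall i : 'I_k, forall j : 'I_k, (i < j) ==> (x i < x j)].

Definition contains (n m k : nat) (pi : 'S_n) (p : arrow_pattern m k) : bool :=
  [exists x : {ffun 'I_k -> 'I_n}, [&& increasing x,
     [exists t : {ffun 'I_m -> 'I_n},
        increasing t && [forall j, pi (t j) == x (tnth (letters p) j)]]
   & [forall b, forall c, ((b, c) \in arrows p) ==> (hat pi (x b) == x c)]]].

Definition avoid_count (n m k : nat) (p : arrow_pattern m k) : nat :=
  #|[set pi : 'S_n | ~~ contains pi p]|.

Section Pattern12_13.

Let l1 : 'I_3 := @Ordinal 3 0 isT.
Let l2 : 'I_3 := @Ordinal 3 1 isT.
Let l3 : 'I_3 := @Ordinal 3 2 isT.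

Fact pattern_12_arrow_1_3_cover :
  [forall a : 'I_3, (a \in [tuple l1; l2]) ||
     [exists c : 'I_3, ((a, c) \in [set (l1, l3)]) || ((c, a) \in [set (l1, l3)])]].
Proof.
apply/forallP=> -[[|[|[|//]]] a3]; rewrite !inE //=.
by apply/existsP; exists l1; rewrite !inE.
Qed.

Definition pattern_12_arrow_1_3 : arrow_pattern 2 3 :=
  ArrowPattern pattern_12_arrow_1_3_cover.

End Pattern12_13.

Inductive step := East | North | Diag.

Definition step_code (s : step) : option bool :=
  match s with East => Some true | North => Some false | Diag => None end.
Definition step_decode (b : option bool) : step :=
  match b with Some true => East | Some false => North | None => Diag end.
Lemma step_codeK : cancel step_code step_decode. Proof. by case. Qed.
HB.instance Definition _ := Finite.copy step (can_type step_codeK).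

Definition step_x (s : step) : nat := if s is North then 0 else 1.
Definition step_y (s : step) : nat := if s is East then 0 else 1.
Definition path_x (w : seq step) : nat := sumn (map step_x w).
Definition path_y (w : seq step) : nat := sumn (map step_y w).

Definition schroder_path (m : nat) (w : seq step) : bool :=
  [&& path_x w == m, path_y w == m
    & all (fun i => path_y (take i w) <= path_x (take i w)) (iota 0 (size w).+1)].

(* By this bound, the sum defining schroder ranges over all the paths. *)
Lemma schroder_path_size m w : schroder_path m w -> size w <= m.*2.
Proof.
case/and3P=> /eqP Ex /eqP Ey _; rewrite -addnn -{1}Ex -Ey /path_x /path_y.
elim: w {Ex Ey} => //= s w IH; rewrite addnACA -add1n.
by apply: leq_add IH; case: s.
Qed.

Definition schroder (m : nat) : nat :=
  \sum_(l < m.*2.+1) #|[set w : l.-tuple step | schroder_path m w]|.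

(* Main.v *)
(** A word fails to avoid the arrow pattern iff some letters x, a, y, b occur in
    it in this order with a < b < x and a < b < y, i.e. iff it contains 4132 or
    3142.  Indeed the image of a letter under the hat permutation is the next
    letter, unless that one is a new left-to-right maximum, in which case it is
    the current left-to-right maximum; moving from a towards y, the first step
    that jumps over b gives the occurrence of the arrow pattern.
      If b is the last letter of a word avoiding 4132 and 3142, the letters
    larger than b form a contiguous block; this block and the word where it is
    contracted to one letter are arbitrary words avoiding 4132 and 3142.  Hence
    a(n+1) = a(n) + sum_(b < n) a(b+1) a(n-b), which is the first-return
    recurrence of the large Schroder numbers. *)
Require Import Defs.
From mathcomp Require Import all_boot.
From mathcomp Require Import perm zify.
Set Implicit Arguments.
Unset Strict Implicit.
Unset Printing Implicit Defensive.

(** * Counting by duplicate-free lists; subsequences *)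

(** Avoidance of 4132 and 3142 is a [Prop] on words over all naturals, so words and paths are
    counted by lists rather than by cardinals of finite types. *)
Definition enumerates (T : eqType) (P : T -> Prop) (s : seq T) :=
  uniq s /\ forall x, x \in s <-> P x.

Lemma enumerates_size (T : eqType) (P Q : T -> Prop) (s t : seq T) :
  enumerates P s -> enumerates Q t -> (forall x, P x <-> Q x) ->
  size s = size t.
Proof.
move=> [us sP] [ut tQ] PQ; apply/perm_size/uniq_perm => // x.
by apply/idP/idP => [/sP/PQ/tQ|/tQ/PQ/sP].
Qed.

(** The shape common to both recurrences: an index [k] together with an independent choice of two
    smaller objects. *)
Lemma size_sum_allpairs (n : nat) (T U V : Type) (f : nat -> T -> U -> V)
    (s : nat -> seq T) (t : nat -> seq U) :
  size [seq f k p.1 p.2 | k <- iota 0 n, p <- [seq (x, y) | x <- s k, y <- t k]]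
  = \sum_(k < n) size (s k) * size (t k).
Proof.
rewrite size_allpairs_dep sumnE big_map -{1}[n]subn0 -/(index_iota 0 n) big_mkord.
by apply: eq_bigr => k _; rewrite size_allpairs.
Qed.

Lemma subseq_catP (T : eqType) (s l r : seq T) :
  subseq s (l ++ r) ->
  exists s1 s2, [/\ s = s1 ++ s2, subseq s1 l & subseq s2 r].
Proof.
case/subseqP=> m szm ->; rewrite size_cat in szm.
exists (mask (take (size l) m) l), (mask (drop (size l) m) r).
rewrite !mask_subseq -mask_cat ?cat_take_drop // size_take szm.
by case: ltngtP (leq_addr (size r) (size l)).
Qed.

Lemma subseq_mapP (T U : eqType) (f : T -> U) (s : seq U) (w : seq T) :
  subseq s (map f w) -> exists2 s', s = map f s' & subseq s' w.
Proof.
case/subseqP=> m _ ->; exists (mask m w); first by rewrite map_mask.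
exact: mask_subseq.
Qed.

(** * Schröder paths and their first-return recurrence *)

(* h is the height x - y of the starting point below the diagonal. *)
Fixpoint excursion (h : nat) (w : seq step) : bool :=
  match w with
  | [::] => h == 0
  | East :: w' => excursion h.+1 w'
  | North :: w' => if h is h'.+1 then excursion h' w' else false
  | Diag :: w' => excursion h w'
  end.

Lemma excursionE h w :
  excursion h w = (h + path_x w == path_y w) &&
    all (fun i => path_y (take i w) <= h + path_x (take i w)) (iota 0 (size w).+1).
Proof.
elim: w h => [|s w IH] h; first by rewrite /= andbT addn0.
have -> : iota 0 (size (s :: w)).+1 = 0 :: map S (iota 0 (size w).+1).
  by rewrite -[S]/(addn 1) -iotaDl.
have r0 : 0 \in iota 0 (size w).+1 by [].
move: (iota _ _) r0 IH => r r0 IH; rewrite [all _ (_ :: _)]/= all_map.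
case: s => /=.
- rewrite IH /path_x /path_y /= add1n addSnnS; congr (_ && _).
  by apply: eq_all => i; rewrite /= add0n add1n addSnnS.
- case: h => [|h].
    (* From height 0, the prefix made of this single [North] step already rises above the
       diagonal. *)
    apply/esym/negP=> /andP[_ /allP/(_ _ r0)].
    by rewrite /path_x /path_y /= take0.
  rewrite IH /path_x /path_y /= add0n add1n addSn eqSS; congr (_ && _).
- rewrite IH /path_x /path_y /= !add1n addnS eqSS; congr (_ && _).
  by apply: eq_all => i; rewrite /= !add1n addnS ltnS.
Qed.

Lemma schroder_pathE m w :
  schroder_path m w = (path_x w == m) && excursion 0 w.
Proof.
rewrite /schroder_path excursionE add0n; case: eqP => //= <-.
by rewrite eq_sym.
Qed.

Lemma excursion_cat k h u v :
  excursion k u -> excursion (k + h) (u ++ v) = excursion h v.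
Proof.
by elim: u k => [|[] u IH] [|k] //=; exact: IH.
Qed.

(** The displayed [North] is the first step that goes below the starting height. The induction is on
    a bound for the length, since the [East] case also calls the hypothesis on a proper suffix. *)
Lemma excursion_first_return h w : excursion h.+1 w ->
  exists u v, [/\ w = u ++ North :: v, excursion 0 u & excursion h v].
Proof.
elim: {w}_.+1 {-2}w h (ltnSn (size w)) => // m IH [|[] w] h //=; rewrite ltnS => szw.
(* After an [East] step the path has to descend twice: the first descent closes the [East] step, the
   second one is the cut. *)
- move/IH => /(_ szw)[u [v [E uP /IH]]] [|u' [v' [E' u'P v'P]]].
    by move: szw; rewrite E size_cat /=; lia.
  exists (East :: u ++ North :: u'), v'; split=> //.
    by rewrite E E' /= -catA.
  by rewrite /= (@excursion_cat 0 1).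
- by exists [::], w.
- by move/IH => /(_ szw)[u [v [-> uP vP]]]; exists (Diag :: u), v.
Qed.

(** If one of [u], [u'] were a proper prefix of the other, the [North] after it would be a step of
    the longer excursion leaving from height 0. *)
Lemma excursion_first_return_inj k u u' v v' :
  excursion k u -> excursion k u' -> u ++ North :: v = u' ++ North :: v' ->
  u = u' /\ v = v'.
Proof.
elim: u k u' => [|s u IH] k [|s' u'] /=; first by move=> _ _ [].
- by move=> /eqP-> /= s'P [E]; subst s'.
- by move=> sP /eqP E0 [E]; subst s k.
- move=> us us' [E]; subst s'.
  case: s us us' => [||] us us'; last by case/(IH _ _ us us')=> -> ->.
    by case/(IH _ _ us us')=> -> ->.
  by case: k us us' => // k us us' /(IH _ _ us us')[-> ->].
Qed.

Lemma path_x_cat u v : path_x (u ++ v) = path_x u + path_x v.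
Proof. by rewrite /path_x map_cat sumn_cat. Qed.

Definition schroder_paths m : seq (seq step) :=
  [seq tval p | l <- iota 0 m.*2.+1, p <- enum [set w : l.-tuple step | schroder_path m w]].

Lemma schroder_paths_enumerates m :
  enumerates (fun w => schroder_path m w) (schroder_paths m).
Proof.
split.
  apply: allpairs_uniq_dep; first exact: iota_uniq.
    by move=> l _; apply: enum_uniq.
  move=> [l p] [l' p'] _ _ /= E.
  have El : l = l' by rewrite -(size_tuple p) E size_tuple.
  by subst l'; congr Tagged; apply: val_inj.
move=> w; split.
  by case/allpairsPdep=> l [p [_ + ->]]; rewrite mem_enum inE.
move=> wP; apply/allpairsPdep; exists (size w), (in_tuple w); split=> //.
  by rewrite mem_iota ltnS (schroder_path_size wP).
by rewrite mem_enum inE.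
Qed.

Lemma size_schroder_paths m : size (schroder_paths m) = schroder m.
Proof.
rewrite size_allpairs_dep sumnE big_map -[X in iota 0 X]subn0 -/(index_iota 0 _).
by rewrite big_mkord; apply: eq_bigr => k _; rewrite cardE.
Qed.

Lemma schroder0 : schroder 0 = 1.
Proof.
rewrite -size_schroder_paths; apply: (@enumerates_size _ _ (fun w => w = [::]) _ [:: [::]]).
- exact: schroder_paths_enumerates.
- by split=> // x; rewrite inE; split=> [/eqP|->].
- move=> w; split=> [/schroder_path_size|-> //].
  by case: w.
Qed.

(** A path either begins with [Diag], or begins with an [East] step matched by the [North] step of
    the first return to the diagonal, at abscissa [k.+1]. *)
Lemma schroderS m :
  schroder m.+1 = schroder m + \sum_(k < m.+1) schroder k * schroder (m - k).
Proof.
pose L := [seq East :: p.1 ++ North :: p.2 | k <- iota 0 m.+1,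
   p <- [seq (u, v) | u <- schroder_paths k, v <- schroder_paths (m - k)]].
have memP k := (schroder_paths_enumerates k).2.
have uP k := (schroder_paths_enumerates k).1.
rewrite -size_schroder_paths -(size_schroder_paths m).
under eq_bigr => k _ do rewrite -!size_schroder_paths.
rewrite -(size_sum_allpairs _ (fun _ u v => East :: u ++ North :: v)
  schroder_paths (fun k => schroder_paths (m - k))) -/L.
rewrite -[size (schroder_paths m)](size_map (cons Diag)) -size_cat.
apply: (@enumerates_size _ _
  (fun w => w \in map (cons Diag) (schroder_paths m) ++ L) _ _
  (schroder_paths_enumerates _)).
  split=> //; rewrite cat_uniq map_inj_uniq ?uP /=; last by move=> ? ? [].
  apply/andP; split.
    apply/hasPn=> w /allpairsPdep[k [p [_ _ ->]]].
    by apply/negP=> /mapP[].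
  apply: allpairs_uniq_dep; first exact: iota_uniq.
    move=> k _; apply: allpairs_uniq => //.
    by move=> [? ?] [? ?].
  move=> _ _ /allpairsPdep[k [p [_ kp ->]]] /allpairsPdep[k' [p' [_ k'p' ->]]] /=.
  case/allpairsP: kp => -[u v] /= [/memP uk _ ->].
  case/allpairsP: k'p' => -[u' v'] /= [/memP uk' _ ->].
  (* The indices are [path_x u] and [path_x u'], so only the two pieces have to be recovered. *)
  move=> [E]; move: uk uk'; rewrite !schroder_pathE => /andP[/eqP<- eu] /andP[/eqP<- eu'].
  by have [-> ->] := excursion_first_return_inj eu eu' E.
move=> w; rewrite schroder_pathE mem_cat; split.
- case: w => [|[] w] //= /andP[].
  + rewrite /path_x /= add1n eqSS => /eqP Ex.
    case/excursion_first_return=> u [v [Ew eu ev]]; subst w.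
    move: Ex; rewrite -/(path_x _) path_x_cat [X in _ + X]/path_x /= add0n -/(path_x _) => Ex.
    apply/orP; right; apply/allpairsPdep; exists (path_x u), (u, v); split=> //.
      by rewrite mem_iota; lia.
    apply/allpairsP; exists (u, v); split=> //=; apply/memP; rewrite schroder_pathE ?eqxx //.
    by rewrite ev -Ex addKn eqxx.
  + by [].
  + rewrite /path_x /= add1n eqSS => Ex ew; rewrite map_f //.
    by apply/memP; rewrite schroder_pathE ew andbT.
- case/orP=> [/mapP[v /memP + ->]|].
    by rewrite schroder_pathE /path_x /= add1n eqSS.
  case/allpairsPdep=> k [p [km kp ->]]; rewrite mem_iota in km.
  case/allpairsP: kp => -[u v] /= [/memP + /memP + ->].
  rewrite !schroder_pathE =>  /andP[/eqP xu eu] /andP[/eqP xv ev].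
  rewrite (@excursion_cat 0 1) //= ev andbT.
  have -> : East :: u ++ North :: v = [:: East] ++ u ++ [:: North] ++ v by [].
  by rewrite !path_x_cat xu xv /path_x /=; lia.
Qed.

(** * Words avoiding 4132 and 3142, and their blocks *)

Lemma filter_predC_nil (T : Type) (p : pred T) (s : seq T) :
  all (predC p) s -> filter p s = [::].
Proof.
by rewrite all_predC has_count -size_filter -eqn0Ngt => /nilP.
Qed.

(** What the word in front of a final letter [b] has to satisfy for [b] not to end a forbidden
    occurrence. *)
Definition separates (b : nat) (w : seq nat) : Prop :=
  forall x a y, subseq [:: x; a; y] w -> ~~ [&& a < b, b < x & b < y].

(* Avoidance of the classical patterns 4132 and 3142. *)
Definition avoids (w : seq nat) : Prop :=
  forall x a y b, subseq [:: x; a; y; b] w -> ~~ [&& a < b, b < x & b < y].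

Lemma avoids_subseq v w : subseq v w -> avoids w -> avoids v.
Proof. by move=> vw avw x a y b s; apply: avw (subseq_trans s vw). Qed.

Lemma avoids_map (f : nat -> nat) w :
  {in w &, {mono f : x y / x < y}} -> avoids (map f w) <-> avoids w.
Proof.
move=> fm; split=> avw x a y b s.
  have [xw aw yw bw] : [/\ x \in w, a \in w, y \in w & b \in w].
    by split; apply: (mem_subseq s); rewrite !inE eqxx ?orbT.
  by rewrite -!(fm a, fm b, fm _ a, fm _ b) //; apply: avw; apply: (map_subseq f s).
case/subseq_mapP: s => [[|x' [|a' [|y' [|b' [|? ?]]]]]] // [-> -> -> ->] s.
have [xw aw yw bw] : [/\ x' \in w, a' \in w, y' \in w & b' \in w].
  by split; apply: (mem_subseq s); rewrite !inE eqxx ?orbT.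
by rewrite !fm //; apply: avw.
Qed.

Lemma avoids_rcons w b : avoids (rcons w b) <-> avoids w /\ separates b w.
Proof.
rewrite -cats1; split=> [avw|[avw sep] x a y c].
  split; first by apply: avoids_subseq avw; apply: prefix_subseq.
  move=> x a y s; apply: avw.
  by rewrite -[[:: x; a; y; b]]/([:: x; a; y] ++ [:: b]) cat_subseq.
case/subseq_catP=> s1 [s2 [E sub1 sub2]].
case: s2 E sub2 => [|c' [|? ?]]; last 1 first.
- by move=> _ /size_subseq.
- by rewrite cats0 => E _; apply: avw; rewrite E.
rewrite cats1 -[LHS]/(rcons [:: x; a; y] c) => /rcons_inj[E <-].
by rewrite sub1seq inE => /eqP->; apply: sep; rewrite E.
Qed.

(** Letters are added on the left. A letter above [b] put in front of nonempty [l] and [m] would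
    form the forbidden triple with their heads. *)
Lemma separates_split b w : b \notin w -> separates b w ->
  exists l m r, [/\ w = l ++ m ++ r, all (fun z => z < b) l,
    all (fun z => b < z) m & all (fun z => z < b) r].
Proof.
elim: w => [|t w IH]; first by exists [::], [::], [::].
rewrite inE negb_or => /andP[bt bw] sep.
have [|l [m [r [Ew lP mP rP]]]] := IH bw.
  by move=> x a y s; apply: sep; apply: subseq_trans s _; apply: subseq_cons.
case: (ltngtP t b) bt => [tb|bt|->] // _.
  by exists (t :: l), m, r; rewrite /= Ew tb.
case: l Ew lP => [|a l] Ew lP.
  by exists [::], (t :: m), r; rewrite /= Ew bt.
(* If no letter exceeds [b] so far, [t] alone becomes the block and everything else goes to its
   right. *)
case: m Ew mP => [|y m] Ew mP.
  by exists [::], [:: t], ((a :: l) ++ r); rewrite Ew all_cat lP rP /= bt.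
have tay : subseq [:: t; a; y] (t :: w).
  by rewrite Ew /= !eqxx sub1seq mem_cat mem_head orbT.
have := sep _ _ _ tay.
by case/andP: lP => -> _; case/andP: mP => -> _; rewrite bt.
Qed.

Lemma filter_block b (p : pred nat) l m r :
  all (fun z => z < b) l -> all (fun z => z < b) r ->
  (forall z, z < b -> p z) ->
  [seq z <- l ++ m ++ r | p z] = l ++ [seq z <- m | p z] ++ r.
Proof.
move=> lP rP pP; rewrite !filter_cat.
have pall s : all (fun z => z < b) s -> [seq z <- s | p z] = s.
  by move=> sP; apply/all_filterP; apply: sub_all sP.
by rewrite (pall l) // (pall r).
Qed.

Section Block.

Variables (b : nat) (l m r : seq nat).
Hypotheses (lP : all (fun z => z < b) l) (mP : all (fun z => b < z) m)
  (rP : all (fun z => z < b) r).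

Lemma filter_block_gt : [seq z <- l ++ m ++ r | b < z] = m.
Proof.
have small s : all (fun z => z < b) s -> [seq z <- s | b < z] = [::].
  move=> sP; apply: filter_predC_nil; apply: sub_all sP => z /=.
  by rewrite -leqNgt; apply: ltnW.
by rewrite !filter_cat (small l) // (small r) // cats0; apply/all_filterP.
Qed.

(** A letter [x] above [b] is not in [l] and a letter [y] above [b] is not in [r], so [a] would lie
    in [m], where no letter is below [b]. *)
Lemma separates_block : separates b (l ++ m ++ r).
Proof.
move=> x a y s; apply/negP=> /and3P[ab bx by_].
have [s1 [s2 [E sl smr]]] := subseq_catP s.
case: s1 E sl => [|x' s1] /= E sl; last first.
  case: E => Ex _; have /(allP lP) : x \in l by rewrite (mem_subseq sl) // Ex mem_head.
  by rewrite ltnNge (ltnW bx).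
move: smr; rewrite -E => /subseq_catP[t1 [t2 [F sm sr]]].
case/lastP: t2 F sr => [|t2 y'] F sr.
  have /(allP mP) : a \in m by rewrite (mem_subseq sm) // -[t1]cats0 -F !inE eqxx orbT.
  by rewrite ltnNge (ltnW ab).
have Ey : y = y' by move/(congr1 (last 0)): F; rewrite last_cat last_rcons.
have /(allP rP) : y \in r by rewrite (mem_subseq sr) // mem_rcons Ey mem_head.
by rewrite ltnNge (ltnW by_).
Qed.

(** Both [b] and [z] exceed all letters of [l] and [r], so the two words are order-isomorphic. Thus
    any letter of the block may represent it. *)
Lemma avoids_block_collapse z : b < z -> avoids (l ++ z :: r) <-> avoids (l ++ b :: r).
Proof.
move=> bz; pose f t := if t == b then z else t.
have fid s : all (fun z => z < b) s -> map f s = s.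
  move=> sP; rewrite -[RHS]map_id; apply/eq_in_map => t /(allP sP).
  by rewrite /f; case: eqP => // ->; rewrite ltnn.
have -> : l ++ z :: r = map f (l ++ b :: r).
  by rewrite map_cat /= !fid // {1}/f eqxx.
have leb t : t \in l ++ b :: r -> t <= b.
  by rewrite mem_cat inE => /or3P[/(allP lP)/ltnW|/eqP->|/(allP rP)/ltnW].
apply: avoids_map => s t /leb sb /leb tb; rewrite /f.
by do 2!case: eqP; lia.
Qed.

(** Consider an occurrence x, a, y, e. If e < b, at most one of its letters lies in the block and it
    survives the contraction; if e > b, it lies entirely in the block; and [b] is not a letter of
    the word. *)
Lemma avoids_block : uniq m -> m != [::] ->
  avoids (l ++ m ++ r) <-> avoids m /\ avoids (l ++ b :: r).
Proof.
case: (m) mP separates_block filter_block_gt => // z0 m' m0P sep gtE um _.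
set mm := z0 :: m' in m0P sep gtE um *.
split=> [avw|[avm avlr] x a y e s].
  split.
    by apply: avoids_subseq avw; apply: subseq_trans (suffix_subseq l _); apply: prefix_subseq.
  have bz0 : b < z0 by case/andP: m0P.
  apply/(avoids_block_collapse bz0); apply: avoids_subseq avw.
  by rewrite cat_subseq //= eqxx; apply: suffix_subseq.
apply/negP=> /and3P[ae ex ey].
case: (ltngtP e b) => [eb|be|Eeb].
(* By separation x and y are not both above [b]; [z] is the one that is, or an arbitrary letter of
   the block if neither is. *)
- have [z zm zP] : exists2 z, z \in mm & all (fun t => (t < b) || (t == z)) [:: x; a; y; e].
    have mem_mm t : t \in [:: x; a; y; e] -> b <= t -> t \in mm.
      move=> ts bt; have /(mem_subseq s) := ts.
      rewrite !mem_cat => /or3P[/(allP lP)|//|/(allP rP)]; by rewrite ltnNge bt.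
    have sub_xay : subseq [:: x; a; y] (l ++ mm ++ r).
      by apply: subseq_trans s; rewrite -[[:: x; a; y; e]]/([:: x; a; y] ++ [:: e]) prefix_subseq.
    have := sep _ _ _ sub_xay; rewrite (ltn_trans ae eb) /=.
    case: (ltnP x b) => xb.
      case: (ltnP y b) => yb.
        exists z0; first exact: mem_head.
        by rewrite /= eb (ltn_trans ae eb).
      exists y; first by rewrite mem_mm // !inE eqxx ?orbT.
      by rewrite /= eb (ltn_trans ae eb) eqxx.
    have xm : x \in mm by rewrite mem_mm // !inE eqxx.
    rewrite (allP m0P _ xm) /= -leqNgt => yb.
    have {}yb : y < b.
      rewrite ltn_neqAle yb andbT; apply/eqP=> Ey.
      have /(allP m0P) : y \in mm.
        by apply: mem_mm; rewrite ?Ey // !inE eqxx ?orbT.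
      by rewrite Ey ltnn.
    by exists x => //=; rewrite eqxx yb eb (ltn_trans ae eb).
  have bz := allP m0P _ zm.
  (* Keeping only the letters below [b] and [z] turns the word into [l ++ z :: r] and loses no
     letter of the occurrence. *)
  have := subseq_filter [:: x; a; y; e] (l ++ mm ++ r) (fun t => (t < b) || (t == z)).
  rewrite s zP (filter_block _ lP rP) => [sf|t -> //].
  have fm : [seq t <- mm | (t < b) || (t == z)] = [:: z].
    rewrite -(filter_pred1_uniq um zm); apply: eq_in_filter => t /(allP m0P)/ltnW bt.
    by rewrite ltnNge bt.
  rewrite fm in sf.
  have /(avoids_block_collapse bz) avz := avlr.
  by have /negP[] := avz _ _ _ _ sf; apply/and3P.
- have sub_xay : subseq [:: x; a; y] (l ++ mm ++ r).
    by apply: subseq_trans s; rewrite -[[:: x; a; y; e]]/([:: x; a; y] ++ [:: e]) prefix_subseq.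
  (* Here x and y exceed [b], so separation forces [a] above [b] as well. *)
  have ba : b < a.
    have := sep _ _ _ sub_xay.
    have : a \in l ++ mm ++ r by rewrite (mem_subseq s) // !inE eqxx orbT.
    rewrite (ltn_trans be ex) (ltn_trans be ey) !andbT -leqNgt mem_cat mem_cat.
    case/or3P=> [/(allP lP)|/(allP m0P) //|/(allP rP)]; by rewrite ltnNge => /negbTE ->.
  have := subseq_filter [:: x; a; y; e] (l ++ mm ++ r) (fun t => b < t).
  rewrite s gtE /= ba be (ltn_trans be ex) (ltn_trans be ey) => /avm /negP; apply.
  exact/and3P.
- have : e \in l ++ mm ++ r by rewrite (mem_subseq s) // !inE eqxx ?orbT.
  by rewrite !mem_cat Eeb => /or3P[/(allP lP)|/(allP m0P)|/(allP rP)]; rewrite ltnn.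
Qed.

End Block.

(** * Gluing avoiding permutations and the recurrence for their number *)

Definition avoiding_perm (n : nat) (w : seq nat) : Prop := perm_eq w (iota 0 n) /\ avoids w.

(* With letters counted from 0, the largest letter b of u stands for the block. *)
Definition glue (b : nat) (u v : seq nat) : seq nat :=
  rcons (take (index b u) u ++ map (addn b.+1) v ++ drop (index b u).+1 u) b.

Lemma glue_cat b l r v : b \notin l ->
  glue b (l ++ b :: r) v = rcons (l ++ map (addn b.+1) v ++ r) b.
Proof.
move=> bl; rewrite /glue index_cat (negbTE bl) /= eqxx addn0 take_size_cat //.
by rewrite -cat_rcons drop_size_cat // size_rcons.
Qed.

(** Filter by [p] and by its complement. Used to separate the letters at most [b] from those
    above. *)
Lemma perm_cat_filter (T : eqType) (p : pred T) (s1 s2 t1 t2 : seq T) :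
    all p s1 -> all p t1 -> all (predC p) s2 -> all (predC p) t2 ->
  perm_eq (s1 ++ s2) (t1 ++ t2) -> perm_eq s1 t1 /\ perm_eq s2 t2.
Proof.
move=> ps1 pt1 ps2 pt2 st.
have E := @filter_predC_nil T.
split; [have := perm_filter p st | have := perm_filter (predC p) st];
  rewrite !filter_cat.
  by rewrite !(E _ s2, E _ t2) // !cats0 !(all_filterP _).
have C s : all p s -> all (predC (predC p)) s by apply: sub_all => x /= ->.
by rewrite (E _ s1) ?(E _ t1) ?C // !(all_filterP _).
Qed.

Lemma perm_iota_split b u : perm_eq u (iota 0 b.+1) ->
  exists l r, [/\ u = l ++ b :: r, b \notin l, all (fun z => z < b) l
    & all (fun z => z < b) r].
Proof.
move=> up; have uu : uniq u by rewrite (perm_uniq up) iota_uniq.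
have mu z : (z \in u) = (z < b.+1) by rewrite (perm_mem up) mem_iota.
have bu : b \in u by rewrite mu.
case/path.splitPr: bu uu mu => l r uu mu; exists l, r.
move: uu; rewrite cat_uniq /= => /and4P[_ /norP[bl _] br _].
split=> //; apply/allP=> z zs; have := mu z; rewrite mem_cat inE zs ?orbT ltnS => /esym;
  rewrite leq_eqVlt => /orP[/eqP zb|//]; by rewrite -zb zs in bl br.
Qed.

Lemma all_addn b v : all (fun z => b < z) (map (addn b.+1) v).
Proof. by rewrite all_map; apply/allP=> z _ /=; rewrite addSn ltnS leq_addr. Qed.

Lemma avoids_addn c v : avoids (map (addn c) v) <-> avoids v.
Proof. by apply: avoids_map => x y _ _; rewrite ltn_add2l. Qed.

Lemma avoiding_perm_size n w : avoiding_perm n w -> size w = n.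
Proof. by case=> /perm_size -> _; rewrite size_iota. Qed.

Lemma avoiding_perm_uniq n w : avoiding_perm n w -> uniq w.
Proof. by case=> /perm_uniq -> _; rewrite iota_uniq. Qed.

(** No letter of [u] exceeds [n], so the separation condition is vacuous. *)
Lemma avoiding_perm_rcons n u : avoiding_perm n u <-> avoiding_perm n.+1 (rcons u n).
Proof.
have E : perm_eq (rcons u n) (iota 0 n.+1) = perm_eq u (iota 0 n).
  by rewrite -cats1 -addn1 iotaD perm_cat2r.
rewrite /avoiding_perm E avoids_rcons; split=> [[up avu]|[up [avu _]]] //; split=> //; split=> //.
move=> x a y /mem_subseq/(_ x); rewrite mem_head (perm_mem up) mem_iota /= => /(_ isT) xn.
by rewrite [n < x]ltnNge (ltnW xn) andbF.
Qed.

Lemma glue_perm (b : nat) (l m r : seq nat) :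
  perm_eq (rcons (l ++ m ++ r) b) ((l ++ b :: r) ++ m).
Proof. by apply/seq.permP=> p; rewrite -cats1 !count_cat /=; lia. Qed.

Lemma iota_split b n : b <= n ->
  iota 0 n.+1 = iota 0 b.+1 ++ map (addn b.+1) (iota 0 (n - b)).
Proof. by move=> bn; rewrite -iotaDl addn0 -[in RHS](add0n b.+1) -iotaD -subSS subnKC. Qed.

Lemma avoiding_perm_glue n b u v : b < n -> avoiding_perm b.+1 u -> avoiding_perm (n - b) v ->
  avoiding_perm n.+1 (glue b u v).
Proof.
move=> bn [up avu] vA; have [vp avv] := vA.
have [l [r [E bl lP rP]]] := perm_iota_split up.
rewrite E in up avu *; rewrite glue_cat //; split.
  rewrite (iota_split (ltnW bn)); apply: perm_trans (glue_perm _ _ _ _) _.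
  by apply: perm_cat => //; apply: perm_map.
apply/avoids_rcons; split; last exact: separates_block (all_addn _ _) _.
apply/(avoids_block lP (all_addn _ _) rP); last by rewrite avoids_addn.
- by rewrite map_inj_uniq ?(avoiding_perm_uniq vA) //; apply: addnI.
- by rewrite -size_eq0 size_map (avoiding_perm_size vA) subn_eq0 -ltnNge.
Qed.

Lemma avoiding_permS n w : avoiding_perm n.+1 w ->
  (exists2 u, avoiding_perm n u & w = rcons u n) \/
  exists b u v, [/\ b < n, avoiding_perm b.+1 u, avoiding_perm (n - b) v & w = glue b u v].
Proof.
case/lastP: w => [[/perm_size]|w b] //  wA; have [wp] := wA.
have wu := avoiding_perm_uniq wA.
have : b \in rcons w b by rewrite mem_rcons mem_head.
rewrite (perm_mem wp) mem_iota /= add0n ltnS leq_eqVlt => /orP[/eqP Eb|bn].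
  by left; exists w; [apply/avoiding_perm_rcons; rewrite -{2}Eb | rewrite Eb].
case/avoids_rcons=> avw sepw; right.
move: wu; rewrite rcons_uniq => /andP[bw uw].
have [l [m [r [E lP mP rP]]]] := separates_split bw sepw; subst w.
(* Subtracting [b.+1] standardizes the block, whose letters all exceed [b]. *)
have Em : m = map (addn b.+1) (map (subn^~ b.+1) m).
  rewrite -map_comp -[LHS]map_id; apply/eq_in_map => z /(allP mP) bz /=.
  by rewrite subnKC.
(* The final [b] is moved to the place of the block, then letters are sorted out by comparison with
   [b]. *)
have [up mp] : perm_eq (l ++ b :: r) (iota 0 b.+1) /\
    perm_eq m (map (addn b.+1) (iota 0 (n - b))).
  apply: (@perm_cat_filter _ (fun z => z <= b)).
  - rewrite all_cat /= leqnn /= !(sub_all _ lP, sub_all _ rP) // => z; exact: ltnW.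
  - by apply/allP=> z; rewrite mem_iota.
  - by apply: sub_all mP => z /=; rewrite -ltnNge.
  - by apply: sub_all (all_addn _ _) => z /=; rewrite -ltnNge.
  rewrite -iota_split 1?ltnW //; apply: perm_trans wp.
  by rewrite perm_sym glue_perm.
have m0 : m != [::].
  by rewrite -size_eq0 (perm_size mp) size_map size_iota subn_eq0 -ltnNge.
have um : uniq m by move: uw; rewrite !cat_uniq => /and3P[_ _ /and3P[]].
have [avm avu] := (avoids_block lP mP rP um m0).1 avw.
have bl : b \notin l by apply/negP=> /(allP lP); rewrite ltnn.
exists b, (l ++ b :: r), (map (subn^~ b.+1) m); split=> //.
- split; last by apply/(avoids_addn b.+1); rewrite -Em.
  by apply: (@perm_map_inj _ _ (addn b.+1)); rewrite -?Em //; apply: addnI.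
- by rewrite glue_cat // -Em.
Qed.

(** The last letter gives [b], the letters above it give [v], and the position of the first of them
    tells where [b] stood in [u]. That position exists because [b < n] makes [v] nonempty. *)
Lemma glue_inj n b b' u u' v v' :
    b < n -> b' < n -> avoiding_perm b.+1 u -> avoiding_perm b'.+1 u' ->
    avoiding_perm (n - b) v -> avoiding_perm (n - b') v' ->
  glue b u v = glue b' u' v' -> [/\ b = b', u = u' & v = v'].
Proof.
move=> bn _ [up _] [u'p _] vA v'A.
have [l [r [-> bl lP rP]]] := perm_iota_split up.
have [l' [r' [-> b'l' l'P r'P]]] := perm_iota_split u'p.
rewrite !glue_cat // => /rcons_inj[E Eb]; subst b'.
have Ev : map (addn b.+1) v = map (addn b.+1) v'.
  by rewrite -(filter_block_gt lP (all_addn b v) rP) E filter_block_gt ?all_addn.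
have findE s t : all (fun z => z < b) s ->
    find (fun z => b < z) (s ++ map (addn b.+1) v ++ t) = size s.
  move=> sP; have /negbTE sN : ~~ has (fun z => b < z) s.
    by apply/hasPn=> z /(allP sP) zb; rewrite -leqNgt ltnW.
  rewrite find_cat sN; case: (v) (avoiding_perm_size vA) => [/esym/eqP|z ? _].
    by rewrite subn_eq0 leqNgt bn.
  by rewrite /= addSn ltnS leq_addr addn0.
have Esz : size l = size l' by rewrite -(findE l r) // E -Ev findE.
move/eqP: E; rewrite eqseq_cat // => /andP[/eqP-> ]; rewrite Ev eqseq_cat //.
by case/andP=> _ /eqP->; split=> //; apply: inj_map Ev; apply: addnI.
Qed.

Lemma avoiding_perm_count_rec (A : nat -> seq (seq nat)) n :
    (forall k, enumerates (avoiding_perm k) (A k)) ->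
  size (A n.+1) = size (A n) + \sum_(b < n) size (A b.+1) * size (A (n - b)).
Proof.
move=> AP; have memP k := (AP k).2; have uP k := (AP k).1.
pose L := [seq glue b p.1 p.2 | b <- iota 0 n,
  p <- [seq (u, v) | u <- A b.+1, v <- A (n - b)]].
rewrite -(size_sum_allpairs n glue (fun b => A b.+1) (fun b => A (n - b))) -/L.
rewrite -[size (A n)](size_map (rcons^~ n)) -size_cat.
have LP w : w \in L -> exists b u v,
    [/\ b < n, avoiding_perm b.+1 u, avoiding_perm (n - b) v & w = glue b u v].
  case/allpairsPdep=> b [p [bn bp ->]]; case/allpairsP: bp => -[u v] /= [/memP ? /memP ? ->].
  by exists b, u, v; split=> //; move: bn; rewrite mem_iota.
apply: (enumerates_size (AP _) (t := map (rcons^~ n) (A n) ++ L)); first last.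
- by move=> w; apply: iff_refl.
split.
  rewrite cat_uniq map_inj_uniq ?uP /=; last exact: rcons_injl.
  apply/andP; split.
    apply/hasPn=> w /LP[b [u [v [bn _ _ ->]]]]; apply/negP=> /mapP[u' _ /rcons_inj[_ E]].
    by rewrite E ltnn in bn.
  apply: allpairs_uniq_dep; first exact: iota_uniq.
    by move=> b _; apply: allpairs_uniq => // -[? ?] [? ?].
  move=> _ _ /allpairsPdep[b [p [bn bp ->]]] /allpairsPdep[b' [p' [b'n b'p' ->]]] /=.
  case/allpairsP: bp => -[u v] /= [/memP uA /memP vA ->].
  case/allpairsP: b'p' => -[u' v'] /= [/memP u'A /memP v'A ->] /= E.
  rewrite !mem_iota in bn b'n.
  by have [-> -> ->] := glue_inj bn b'n uA u'A vA v'A E.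
move=> w; rewrite mem_cat; split.
  case/orP=> [/mapP[u /memP uA ->]|/LP[b [u [v [bn uA vA ->]]]]].
    exact: (avoiding_perm_rcons n u).1 uA.
  exact: avoiding_perm_glue.
case/avoiding_permS=> [[u uA ->]|[b [u [v [bn uA vA ->]]]]].
  by apply/orP; left; apply/mapP; exists u => //; apply/memP.
apply/orP; right; apply/allpairsPdep; exists b, (u, v); split=> //.
  by rewrite mem_iota.
by apply/allpairsP; exists (u, v); split=> //=; apply/memP.
Qed.

(** * From the arrow pattern to 4132 and 3142 *)

Lemma flatten_split (T : eqType) (C : seq (seq T)) l a r :
  flatten C = l ++ a :: r ->
  exists C1 c1 c2 C2, [/\ C = C1 ++ (c1 ++ a :: c2) :: C2,
    l = flatten C1 ++ c1 & r = c2 ++ flatten C2].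
Proof.
elim: C l => [|c C IH] l /=; first by case: l.
case: (ltnP (size l) (size c)) => lc.
  rewrite -[c in LHS](cat_take_drop (size l)) -catA => /eqP.
  rewrite eqseq_cat ?size_takel ?(ltnW lc) // => /andP[/eqP El].
  have : drop (size l) c != [::] by rewrite -size_eq0 size_drop subn_eq0 -ltnNge.
  case Ed: (drop _ _) => [|z d] //= _ /eqP[Ez <-].
  exists [::], l, d, C; split=> //=.
  by rewrite -[c](cat_take_drop (size l)) El Ed Ez.
rewrite -{1}(cat_take_drop (size c) l) -catA => /eqP.
rewrite eqseq_cat ?size_takel // => /andP[/eqP El /eqP/IH].
case=> C1 [c1 [c2 [C2 [-> Ed ->]]]]; exists (c :: C1), c1, c2, C2.
by split=> //=; rewrite -catA -Ed {1}El cat_take_drop.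
Qed.

Lemma cycle_lt_trans n : transitive (@cycle_lt n).
Proof. by move=> [|y ?] [|x ?] [|z ?] //=; apply: ltn_trans. Qed.

Lemma std_cycle_le n a (c1 c2 : seq 'I_n) z :
  std_cycle (c1 ++ a :: c2) -> z \in c1 ++ a :: c2 -> z <= head a c1.
Proof.
by case: c1 => [|m c1] /= /allP cm; rewrite inE => /orP[/eqP->|/cm/ltnW].
Qed.

(** The cycle of [a] is [c1 ++ a :: c2], with leading letter and maximum [head a c1]. The image of
    [a] is the next letter of the cycle, or the leading letter if [c2] is empty. As leading letters
    increase, this maximum bounds [l], and the next cycle starts above it. *)
Lemma theta_word_step n (s : 'S_n) l a r : theta_word s = l ++ a :: r ->
  exists c1 c2 t, [/\ r = c2 ++ t, s a = head a (c2 ++ c1),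
    forall z, z \in l -> z <= head a c1,
    forall z, z \in c2 -> z <= head a c1
  & {subset c1 <= l} /\ forall z d, t = z :: d -> head a c1 < z].
Proof.
case/flatten_split=> C1 [c1 [c2 [C2 [EC -> ->]]]].
have /andP[] := std_cycle_formP s; rewrite EC all_cat /= => /and3P[C1P cP C2P].
rewrite (sorted_pairwise (@cycle_lt_trans n)) pairwise_cat /= => /and4P[+ _ + _].
rewrite allrel_consr => /andP[C1lt _] C2lt.
have cle z := std_cycle_le (z := z) cP.
exists c1, c2, (flatten C2); split=> //.
- have : c1 ++ a :: c2 \in std_cycle_form s by rewrite EC mem_cat mem_head orbT.
  case/mapP=> m _ Em; have := cycle_orbit (@perm_inj _ s) m.
  rewrite -Em -(rot_cycle (size c1)) rot_size_cat /=.
  by case: (c2 ++ c1) => [|y c] /= /andP[/eqP].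
- move=> z; rewrite mem_cat => /orP[/flattenP[c cC1 zc]|zc1]; last first.
    by apply: cle; rewrite mem_cat zc1.
  have := allP C1P _ cC1; have := allP C1lt _ cC1; case: c zc {cC1} => // m c zc mlt mP.
  have zm : z <= m by apply: (@std_cycle_le _ m [::] c).
  by apply: leq_trans zm (ltnW _); case: (c1) mlt.
- by move=> z zc2; apply: cle; rewrite mem_cat inE zc2 !orbT.
- split; first by move=> z zc1; rewrite mem_cat zc1 orbT.
  case: C2 C2P C2lt {EC} => [|[|m c] C2] //= _ /andP[+ _] z d [<- _].
  by case: (c1).
Qed.

Lemma theta_word_pattern n (s : 'S_n) :
  (exists l a r b, [/\ theta_word s = l ++ a :: r, b \in r, a < b & b < s a]) <->
  (exists x a y b : 'I_n,
     subseq [:: x; a; y; b] (theta_word s) /\ [&& a < b, b < x & b < y]).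
Proof.
split.
  case=> l [a [r [b [Ew br ab bs]]]].
  have [c1 [c2 [t [Er Es lM c2M [c1l tM]]]]] := theta_word_step Ew.
  (* The letter [y] right after [a] is [s a] if it is in the same cycle; otherwise it opens the next
     cycle and exceeds [s a], the maximum of the cycle of [a]. *)
  have [y [d [Eyd by_ bM]]] : exists y d, [/\ r = y :: d, b < y & b < head a c1].
    case: c2 Er Es c2M => [|y c2] /= Er Es c2M; last first.
      rewrite Es in bs; exists y, (c2 ++ t); split=> //.
      exact: leq_trans bs (c2M _ (mem_head _ _)).
    rewrite -Es; case: t Er tM => [|y t] Er tM; first by rewrite Er in br.
    by exists y, t; split=> //; rewrite (ltn_trans bs) // Es (tM _ t).
  exists (head a c1), a, y, b; rewrite ab bM by_; split=> //.
  (* The maximum exceeds [b], hence differs from [a] and stands before it. *)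
  have Ml : head a c1 \in l.
    case: (c1) c1l bM => [|M ? c1l _] /=; first by rewrite ltnNge (ltnW ab).
    by apply: c1l; rewrite mem_head.
  rewrite Ew Eyd -cat1s cat_subseq ?sub1seq //= !eqxx sub1seq.
  by move: br; rewrite Eyd inE => /orP[/eqP Eb|//]; rewrite Eb ltnn in by_.
case=> x [a [y [b [sub /and3P[ab bx by_]]]]].
have uw := theta_word_uniq s.
have [l [r [Ew xl ybr]]] : exists l r,
    [/\ theta_word s = l ++ a :: r, x \in l & subseq [:: y; b] r].
  have aw : a \in theta_word s by apply: (mem_subseq sub); rewrite !inE eqxx orbT.
  case/path.splitPr: aw sub uw => l r sub uw; exists l, r.
  have [s1 [s2 [E sl sr]]] := subseq_catP sub.
  move: uw; rewrite cat_uniq /= negb_or => /and4P[_ /andP[al _] ar _].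
  have xa : x != a by apply/eqP=> xa; move: (ltn_trans ab bx); rewrite xa ltnn.
  case: s1 E sl => [|x1 s1] /= E sl.
    move: sr; rewrite -E /= (negbTE xa) => /mem_subseq/(_ a).
    by rewrite !inE eqxx orbT (negbTE ar) => /(_ isT).
  case: E => Ex; subst x1.
  case: s1 sl => [|a1 s1] sl.
    by move=> /= E; move: sr; rewrite -E /= eqxx => sr; split=> //; rewrite -sub1seq.
  case=> Ea _; subst a1; have := mem_subseq sl (x := a).
  by rewrite !inE eqxx orbT (negbTE al) => /(_ isT).
(* Move [a] rightwards while the next letter [z] is below [b]; [x] stays on its left, [y] and [b] on
   its right. *)
elim: r l a ab Ew xl ybr {sub} => [//|z r IH] l a ab Ew xl ybr.
have br : b \in r.
  move: ybr; rewrite /=; case: eqP => _; first by rewrite sub1seq.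
  by move/mem_subseq; apply; rewrite !inE eqxx orbT.
have [zb|bz|Ezb] := ltngtP z b.
- apply: (IH (rcons l a) z) => //; first by rewrite cat_rcons.
    by rewrite mem_rcons inE xl orbT.
  by move: ybr; rewrite /=; case: eqP => // Ey; move: zb; rewrite -Ey ltnNge (ltnW by_).
(* The image of [a] is [z], or else the maximum of the cycle of [a], which is at least [x]; both
   exceed [b]. *)
- exists l, a, (z :: r), b; split=> //; first by rewrite inE br orbT.
  have [c1 [c2 [t [Er -> lM _ _]]]] := theta_word_step Ew.
  case: c2 Er => [_|z' c2 [<- _]] //=.
  exact: leq_trans bx (lM _ xl).
(* [b] occurs again in [r], so [z] cannot be [b]. *)
- move: uw; rewrite Ew cat_uniq /= => /and5P[_ _ _ + _].
  by rewrite (val_inj Ezb) br.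
Qed.

Lemma contains_patternP n (pi : 'S_n) :
  reflect (exists l a r b, [/\ [seq pi i | i <- enum 'I_n] = l ++ a :: r,
                             b \in r, a < b & b < hat pi a])
          (contains pi pattern_12_arrow_1_3).
Proof.
pose o k (lk : k < 3) : 'I_3 := Ordinal lk.
apply: (iffP existsP).
  case=> x /and3P[/forallP xinc /existsP[t /andP[/forallP tinc /forallP tx]] /forallP arr].
  have ti : t (@Ordinal 2 0 isT) < t (@Ordinal 2 1 isT).
    exact: (implyP (forallP (tinc _) _)).
  have a01 : x (o 0 isT) < x (o 1 isT) by apply: (implyP (forallP (xinc _) _)).
  have a12 : x (o 1 isT) < x (o 2 isT) by apply: (implyP (forallP (xinc _) _)).
  have h02 : hat pi (x (o 0 isT)) = x (o 2 isT).
    by apply/eqP/(implyP (forallP (arr _) _)); rewrite !inE.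
  have /eqP p0 := tx (@Ordinal 2 0 isT); have /eqP p1 := tx (@Ordinal 2 1 isT).
  rewrite !(tnth_nth (o 0 isT)) /= in p0 p1.
  set i := t _ in ti p0; set j := t _ in ti p1.
  exists (map pi (take i (enum 'I_n))), (pi i), (map pi (drop i.+1 (enum 'I_n))), (pi j).
  split.
  - rewrite -map_cons -map_cat -{1}[enum 'I_n](cat_take_drop i); congr (map _ (_ ++ _)).
    by rewrite (drop_nth i) ?size_enum_ord // nth_ord_enum.
  - apply: map_f; rewrite -[j](nth_ord_enum j j) -(subnKC ti) -nth_drop.
    by rewrite mem_nth // size_drop size_enum_ord ltn_sub2r // (leq_ltn_trans ti).
  - by rewrite p0 p1.
  - by rewrite p0 p1 h02.
case=> l [a [r [b [Ew br ab bh]]]].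
have nthw (k : 'I_n) : nth a [seq pi i | i <- enum 'I_n] k = pi k.
  by rewrite (nth_map k) ?size_enum_ord // nth_ord_enum.
have szw : size l + (size r).+1 = n.
  by have := congr1 size Ew; rewrite size_map size_enum_ord size_cat.
have li : size l < n by lia.
have lj : size l + (index b r).+1 < n.
  by rewrite (leq_trans _ (eq_leq szw)) // ltn_add2l ltnS index_mem.
(* The letters 1, 2, 3 of the pattern become [a], [b] and [hat pi a]; [li] and [lj] give the
   positions of the first two in the word. *)
exists [ffun k : 'I_3 => nth a [:: a; b; hat pi a] k]; apply/and3P; split.
- apply/forallP=> -[[|[|[|//]]] ?]; apply/forallP=> -[[|[|[|//]]] ?]; rewrite !ffunE //=.
  exact: ltn_trans ab bh.
- apply/existsP.
  exists [ffun k : 'I_2 => if k == 0 :> nat then Ordinal li else Ordinal lj].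
  apply/andP; split.
    apply/forallP=> -[[|[|//]] ?]; apply/forallP=> -[[|[|//]] ?]; rewrite !ffunE //=.
    by rewrite addnS ltnS leq_addr.
  apply/forallP=> -[[|[|//]] ?]; rewrite !ffunE !(tnth_nth (o 0 isT)) /= -nthw Ew nth_cat /=.
    by rewrite ltnn subnn.
  by rewrite ltnNge leq_addr addKn /= nth_index.
- apply/forallP=> k; apply/forallP=> k'; apply/implyP.
  by rewrite !inE => /eqP[-> ->]; rewrite !ffunE.
Qed.

(** * One-line words as lists of naturals, and the final count *)

Definition word n (pi : 'S_n) : seq nat := [seq val (pi i) | i <- enum 'I_n].

Lemma avoids_patternP n (pi : 'S_n) :
  ~~ contains pi pattern_12_arrow_1_3 <-> avoids (word pi).
Proof.
have Ew : [seq pi i | i <- enum 'I_n] = theta_word (hat pi).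
  by rewrite -theta_wordE; apply: eq_map => i; rewrite /hat f_invF.
have -> : word pi = map val (theta_word (hat pi)) by rewrite -Ew -map_comp.
split=> [/contains_patternP npi|avw].
  move=> x a y b /subseq_mapP[[|x' [|a' [|y' [|b' [|? ?]]]]]] // [-> -> -> ->] s.
  apply/negP=> axy; apply: npi; rewrite Ew.
  by apply/theta_word_pattern; exists x', a', y', b'.
apply/contains_patternP; rewrite Ew => /theta_word_pattern[x [a [y [b [s axy]]]]].
by have := avw _ _ _ _ (map_subseq val s); rewrite axy.
Qed.

Lemma word_inj n : injective (@word n).
Proof.
move=> p q /eq_in_map E; apply/permP=> i; apply: val_inj.
by apply: E; rewrite mem_enum.
Qed.

Lemma word_perm n (pi : 'S_n) : perm_eq (word pi) (iota 0 n).
Proof.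
rewrite /word map_comp -val_enum_ord; apply/perm_map/uniq_perm.
- by rewrite map_inj_uniq ?enum_uniq //; apply: perm_inj.
- exact: enum_uniq.
- by move=> i; rewrite mem_enum -[i](permKV pi) map_f ?mem_enum.
Qed.

Lemma word_surj n w : perm_eq w (iota 0 n) -> exists pi : 'S_n, word pi = w.
Proof.
move=> wp; have szw : size w = n by rewrite (perm_size wp) size_iota.
have uw : uniq w by rewrite (perm_uniq wp) iota_uniq.
have wlt (i : 'I_n) : nth 0 w i < n.
  have : nth 0 w i \in w by rewrite mem_nth // szw.
  by rewrite (perm_mem wp) mem_iota.
have f_inj : injective (fun i => Ordinal (wlt i)).
  move=> i j [/eqP]; rewrite nth_uniq ?szw // => /eqP; exact: val_inj.
exists (perm f_inj); apply: (@eq_from_nth _ 0) => [|k].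
  by rewrite size_map size_enum_ord szw.
rewrite size_map size_enum_ord => kn.
by rewrite (nth_map (Ordinal kn)) ?size_enum_ord // permE /= nth_enum_ord.
Qed.

Definition avoider_words n : seq (seq nat) :=
  [seq word pi | pi <- enum [set pi : 'S_n | ~~ contains pi pattern_12_arrow_1_3]].

Lemma avoider_words_enumerates n : enumerates (avoiding_perm n) (avoider_words n).
Proof.
split; first by rewrite map_inj_uniq ?enum_uniq //; apply: word_inj.
move=> w; split.
  case/mapP=> pi; rewrite mem_enum inE => /avoids_patternP piA ->.
  by split=> //; apply: word_perm.
case=> /word_surj[pi <-] /avoids_patternP piA; apply: map_f.
by rewrite mem_enum inE.
Qed.

Lemma avoid_countE n :
  avoid_count n pattern_12_arrow_1_3 = size (avoider_words n).
Proof. by rewrite size_map -cardE. Qed.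

Theorem theorem3p5 (n : nat) (hn : 1 <= n) :
  avoid_count n pattern_12_arrow_1_3 = schroder n.-1.
Proof.
case: n hn => // n _ /=.
have rec k := @avoiding_perm_count_rec _ k avoider_words_enumerates.
rewrite avoid_countE.
elim/ltn_ind: n => -[|n] IH; rewrite rec.
  (* For length 1 the sum is empty, and what remains is the count for length 0: the empty word
     alone. *)
  rewrite big_ord0 addn0 schroder0.
  apply: (enumerates_size (avoider_words_enumerates 0) (t := [:: [::]])); last first.
    by move=> w; apply: iff_refl.
  split=> // w; rewrite inE; split=> [/eqP->|[/perm_size/eqP]].
    by split=> // ? ? ? ? /eqP.
  by rewrite size_eq0.
(* The lengths [k.+1] and [n.+1 - k] in each product correspond to the Schröder indices [k] and
   [n - k]. *)
rewrite schroderS IH //; congr (_ + _); apply: eq_bigr => k _.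
by rewrite IH // subSn -1?ltnS // IH // ltnS leq_subr.
Qed.
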